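(* Let $a,b$ be integers with $a\ge b\ge 1$. If $G$ is an edge-colored graph with $|V(G)|=n\ge 2$ and $\delta^c(G)\ge 2\ln n+4(a-1)$, then $G$ has an $(a,b)$-feasible partition, i.e. $V(G)$ can be partitioned into two non-empty sets $A$ and $B$ such that $\delta^c(G[A])\ge a$ and $\delta^c(G[B])\ge b$.
   Context: All graphs are finite and simple. An edge-colored graph is a graph together with an arbitrary (not necessarily proper) assignment of a color to each edge. For a vertex $v$ of an edge-colored graph $G$, the color degree $d^c_G(v)$ is the number of distinct colors appearing on the edges of $G$ incident with $v$, and $\delta^c(G)=\min\{d^c_G(v): v\in V(G)\}$. $G[A]$ is the subgraph induced by $A$ with the inherited edge-coloring. $\ln$ is the natural logarithm. *)

(* Defs.v *)
From mathcomp Require Import all_boot.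

Set Implicit Arguments.
Unset Strict Implicit.
Unset Printing Implicit Defensive.

(* [color u v] is only meaningful on edges; [color_sym] makes it a function of
   the unordered edge [{u, v}]. *)
Record ecgraph (C : eqType) := ECGraph {
  vertex :> finType;
  adj : rel vertex;
  color : vertex -> vertex -> C;
  adj_sym : symmetric adj;
  adj_irr : irreflexive adj;
  color_sym : forall u v, adj u v -> color u v = color v u
}.

Section ColorDegree.
Variables (C : eqType) (G : ecgraph C).

Definition color_degree (v : G) : nat :=
  size (undup [seq color v w | w in [pred w | adj v w]]).

Lemma color_degree_lt_card (v : G) : color_degree v < #|G|.
Proof.
apply: (leq_ltn_trans (size_undup _)); rewrite size_map -cardE.
apply: proper_card; apply/properP; split; first exact/subsetP.
by exists v; rewrite // inE adj_irr.
Qed.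

(* As every color degree is below [#|G|], the default value [#|G|] does not
   affect the minimum unless [G] has no vertex, in which case the value is 0. *)
Definition min_color_degree : nat :=
  \big[minn/#|G|]_(v : G) color_degree v.

Lemma min_color_degree_le (v : G) : min_color_degree <= color_degree v.
Proof.
rewrite /min_color_degree.
have: v \in index_enum G by rewrite mem_index_enum.
elim: (index_enum G) => [//|x s IHs]; rewrite inE big_cons geq_min.
by case/orP => [/eqP ->|/IHs ->]; rewrite ?leqnn ?orbT.
Qed.

Lemma min_color_degree_attained :
  0 < #|G| -> exists v : G, min_color_degree = color_degree v.
Proof.
case/card_gt0P => v0 _.
have [] : min_color_degree = #|G| \/
          exists v : G, min_color_degree = color_degree v.
- rewrite /min_color_degree; elim/big_ind: _ => [|x y Hx Hy|v _].
  + by left.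
  + by case: (leqP x y).
  + by right; exists v.
- move=> E; have := leq_ltn_trans (min_color_degree_le v0)
                                  (color_degree_lt_card v0).
  by rewrite E ltnn.
- by [].
Qed.

Section Induced.
Variable A : {set G}.

Let iV : finType := {x : G | x \in A}.
Let iadj : rel iV := fun u v => adj (val u) (val v).
Let icolor (u v : iV) : C := color (val u) (val v).

Fact iadj_sym : symmetric iadj.
Proof. by move=> u v; apply: adj_sym. Qed.

Fact iadj_irr : irreflexive iadj.
Proof. by move=> u; apply: adj_irr. Qed.

Fact icolor_sym (u v : iV) : iadj u v -> icolor u v = icolor v u.
Proof. exact: color_sym. Qed.

Definition induced : ecgraph C := ECGraph iadj_sym iadj_irr icolor_sym.

End Induced.

End ColorDegree.

Definition feasible_partition (C : eqType) (G : ecgraph C) (a b : nat)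
    (A B : {set G}) : Prop :=
  [/\ A != set0, B != set0, A :|: B = [set: G] & [disjoint A & B]] /\
  (a <= min_color_degree (induced A) /\ b <= min_color_degree (induced B)).

(* Main.v *)
Require Import Defs.
From mathcomp Require Import all_boot all_order all_algebra.
From mathcomp Require Import reals sequences exp.
From mathcomp Require Import zify ring lra.

(** As [b <= a], it suffices that both sides of the partition have minimum
    colour degree at least [a = k + 1], and a uniformly random set of vertices
    together with its complement achieves this with positive probability.

    Write [d] for the minimum colour degree and [n] for the number of vertices.
    Fix for each vertex [v] a set of [d] neighbours joined to [v] by edges of
    distinct colours ([rainbow_neighbours]).  The number [X] of them lying on
    the same side as [v] is binomial with parameters [d] and [1/2], and if it
    exceeds [k] for every [v], both sides have the required colour degree
    ([min_color_degree_induced_ge]).  Markov's inequality for [x ^ (d - X)]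
    gives
      [P (X <= k) <= x ^ k * ((x + 1) / (2 * x)) ^ d]
    for every [x >= 1] ([card_few_same_side]).

    Put [m = d - 4 * k].  The degree hypothesis says [ln n <= m / 2], and
    [exp (1 / 2) <= 5 / 3], so [n <= (5 / 3) ^ m] ([log_degree_bound]).  With
    [x = 5] the union bound over the [n] vertices is then at most
      [n * (3 / 5) ^ m * (5 * (3 / 5) ^ 4) ^ k <= (81 / 125) ^ k],
    which is below [3 / 4] for [k >= 1].  For [k = 0] a good [x] is a large
    one, approaching the exact probability [2 ^ - d] that [X = 0]
    ([union_bound_parameter]).

    The constant [3 / 4] leaves room for non-emptiness: once [n >= 3], the
    empty set and the full set make up at most a quarter of all subsets
    ([exists_balanced_set]).  All probabilities are handled as cardinalities
    of sets of subsets, with denominators cleared. *)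

Set Implicit Arguments.
Unset Strict Implicit.
Unset Printing Implicit Defensive.

Definition same_side (T : finType) (v : T) (S : {set T}) : {set T} :=
  [set w | (w \in S) == (v \in S)].

(** The generating function of the number of elements of [D] separated from
    [v] by a random [S]: each of the [#|D|] elements is separated independently
    with probability [1/2], so the expectation is [((x + 1) / 2) ^ #|D|].
    Independence is the expansion of a product of sums over the elements of
    [T] as a sum over subsets. *)
Lemma sum_expn_opposite (T : finType) (D : {set T}) (v : T) (x : nat) :
  v \notin D ->
  (\sum_(S : {set T}) x ^ #|D :\: same_side v S|) * 2 ^ #|D|
    = 2 ^ #|T| * x.+1 ^ #|D|.
Proof.
move=> vD.
(* [h b c w] is the factor of [w] when its membership in [S] is [c] and that of
   [v] is [b]; the factor of [v] itself enforces that its membership is [b]. *)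
pose h (b c : bool) (w : T) : nat :=
  if w == v then nat_of_bool (c == b)
  else if w \in D then (if c == b then 1 else x) else 1.
have hS b (S : {set T}) : \prod_w (if w \in S then h b true w else h b false w)
    = ((v \in S) == b) * x ^ #|D :\: same_side v S|.
  rewrite (bigD1 v) //= {1 2}/h eqxx.
  have -> : (if v \in S then true == b : nat else false == b) = ((v \in S) == b).
    by case: (v \in S).
  case: eqP => [bE|_]; last by rewrite !mul0n.
  rewrite !mul1n -sum1_card expn_sum !(big_mkcond (fun i => i != v)).
  rewrite [RHS]big_mkcond /=; apply: eq_bigr => w _.
  rewrite /h !inE -bE; case: (eqVneq w v) => [->|_] /=.
    by rewrite eqxx.
  by case: (w \in S); case: (v \in S); case: (w \in D); rewrite /= ?expn1.
have hD b : (\prod_w (h b true w + h b false w)) * 2 ^ #|D| * 2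
    = 2 ^ #|T| * x.+1 ^ #|D|.
  rewrite (bigD1 v) //= {1 2}/h eqxx.
  have -> : (true == b) + (false == b) = 1 by case: b.
  rewrite mul1n mulnAC.
  have -> : (\prod_(w | w != v) (h b true w + h b false w)) * 2
     = \prod_w (if w \in D then x.+1 else 2).
    rewrite [RHS](bigD1 v) //= (negPf vD) mulnC; congr (_ * _).
    apply: eq_bigr => w /negPf wv; rewrite /h wv.
    by case: (w \in D); case: b; rewrite //= ?add1n ?addn1.
  have -> : 2 ^ #|D| = \prod_w (if w \in D then 2 else 1).
    by rewrite -big_mkcond prod_nat_const.
  have -> : 2 ^ #|T| = \prod_(w : T) 2 by rewrite prod_nat_const.
  have -> : x.+1 ^ #|D| = \prod_w (if w \in D then x.+1 else 1).
    by rewrite -big_mkcond prod_nat_const.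
  rewrite -!big_split; apply: eq_bigr => w _ /=.
  by case: ifP; rewrite // mulnC.
have -> : \sum_(S : {set T}) x ^ #|D :\: same_side v S|
   = \prod_w (h true true w + h true false w)
     + \prod_w (h false true w + h false false w).
  rewrite !bigA_distr -big_split; apply: eq_bigr => S _ /=.
  rewrite !hS.
  by case: (v \in S); rewrite ?mul1n ?mul0n ?addn0.
by move: (hD true) (hD false); lia.
Qed.

(** Markov's inequality: a set [S] that leaves at most [k] elements of [D] on
    the side of [v] separates at least [#|D| - k] of them, so it contributes
    at least [x ^ (#|D| - k)] to the sum of [sum_expn_opposite]. *)
Lemma card_few_same_side (T : finType) (D : {set T}) (v : T) (x k : nat) :
  v \notin D -> 0 < x ->
  #|[set S : {set T} | #|D :&: same_side v S| <= k]| * (2 * x) ^ #|D|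
    <= x ^ k * (2 ^ #|T| * x.+1 ^ #|D|).
Proof.
move=> vD x0; rewrite -(sum_expn_opposite x vD) expnMn mulnCA mulnC mulnA.
rewrite leq_pmul2r ?expn_gt0 // -sum_nat_const big_distrr /=.
rewrite big_mkcond; apply: leq_sum => S _; rewrite inE.
case: ifP => // few; rewrite -expnD leq_pexp2l //.
by rewrite -{1}(cardsID (same_side v S) D) leq_add2r.
Qed.

(** The union bound.  The hypothesis says that the sets bad for some vertex
    make up less than [3 / 4] of all subsets; [set0] and [setT] must be avoided
    too, and they are at most [2 / 8] of the subsets because [2 < #|T|]. *)
Lemma exists_balanced_set (T : finType) (D : T -> {set T}) (x k d : nat) :
  2 < #|T| -> 0 < x -> (forall v, #|D v| = d) -> (forall v, v \notin D v) ->
  4 * (#|T| * (x ^ k * x.+1 ^ d)) < 3 * (2 * x) ^ d ->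
  exists S : {set T}, [/\ S != set0, S != setT &
    forall v, k < #|D v :&: same_side v S|].
Proof.
move=> T3 x0 cD vD lt.
pose bad v := [set S : {set T} | #|D v :&: same_side v S| <= k].
have [/existsP[S /and3P[S0 ST /forallP allS]]|none] :=
  boolP [exists S : {set T}, [&& S != set0, S != setT & [forall v, S \notin bad v]]].
  by exists S; split=> // v; move: (allS v); rewrite inE -ltnNge.
exfalso; move: lt; apply/negP; rewrite -leqNgt.
have cover : [set: {set T}] \subset [set set0; setT] :|: \bigcup_v bad v.
  apply/subsetP => S _; rewrite !inE.
  move: none; rewrite negb_exists => /forallP/(_ S); rewrite !negb_and !negbK.
  case/or3P => [->//|->|]; rewrite ?orbT // negb_forall.
  case/existsP => v; rewrite negbK => Sv.
  by apply/orP; right; apply/bigcupP; exists v.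
have cardU : #|\bigcup_v bad v| <= \sum_v #|bad v|.
  elim/big_rec2: _ => [|v n U _ IH]; first by rewrite cards0.
  by rewrite (leq_trans (leq_card_setU _ _)) // leq_add2l.
have few : 2 ^ #|T| <= 2 + \sum_v #|bad v|.
  have := subset_leq_card cover; rewrite -powersetT card_powerset cardsT.
  move/leq_trans; apply.
  rewrite (leq_trans (leq_card_setU _ _)) // leq_add //.
  by rewrite cards2; case: (_ != _).
have mk : (\sum_v #|bad v|) * (2 * x) ^ d
    <= #|T| * (x ^ k * (2 ^ #|T| * x.+1 ^ d)).
  rewrite big_distrl -sum_nat_const; apply: leq_sum => v _ /=.
  by have := card_few_same_side k (vD v) x0; rewrite cD.
have T8 : 2 ^ 3 <= 2 ^ #|T| by rewrite leq_exp2l.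
rewrite -(leq_pmul2l (_ : 0 < 2 ^ #|T|)) ?expn_gt0 //.
move: few mk T8; move: (\sum_v _) (2 ^ #|T|) ((2 * x) ^ d) => s N y.
move: (x ^ k) (x.+1 ^ d) => p q; move: #|T| => n few mk T8.
have : 3 * N <= 4 * s by lia.
move=> /(leq_mul (leqnn y)) h1.
rewrite (_ : N * (3 * y) = y * (3 * N)); last by ring.
apply: (leq_trans h1).
rewrite (_ : y * (4 * s) = 4 * (s * y)); last by ring.
rewrite (_ : N * _ = 4 * (n * (p * (N * q)))); last by ring.
by rewrite leq_mul2l.
Qed.

Lemma leq_expl (p q e : nat) : p <= q -> p ^ e <= q ^ e.
Proof. by move=> pq; elim: e => // e IH; rewrite !expnS leq_mul. Qed.

(** The choice of [x].  The best value depends on the ratio of [k] to [m]: as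
    [k / m] tends to [0] it goes to infinity.  The slack in [81 / 125 < 3 / 4]
    lets [x = 5] serve all [k >= 1]; for [k = 0] it remains to make
    [(5 / 3 * (x + 1) / (2 * x)) ^ m] less than [3 / 4]. *)
Lemma union_bound_parameter (n m k : nat) :
  2 < n -> n * 3 ^ m <= 5 ^ m ->
  exists2 x, 0 < x &
    4 * (n * (x ^ k * x.+1 ^ (m + 4 * k))) < 3 * (2 * x) ^ (m + 4 * k).
Proof.
move=> n3 hm; case: k => [|k].
  (* [x = 30] gives the ratio [155 / 180], whose square is just below [3 / 4],
     and [m >= 2] holds because [(5 / 3) ^ 1 < 3 <= n]. *)
  exists 30 => //; rewrite muln0 addn0 mul1n.
  have m2 : 1 < m by case: m hm => [|[|m]] //; lia.
  rewrite -(ltn_pmul2r (_ : 0 < 3 ^ m)) ?expn_gt0 //.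
  have step1 : 4 * (n * 31 ^ m) * 3 ^ m <= 4 * 155 ^ m.
    rewrite (_ : 4 * _ * _ = 4 * (n * 3 ^ m * 31 ^ m)); last by ring.
    by rewrite leq_mul2l /= (expnMn 5 31 m) leq_mul2r hm orbT.
  apply: leq_ltn_trans step1 _.
  rewrite -mulnA -expnMn -(subnK m2) !expnD.
  have : 155 ^ (m - 2) <= 180 ^ (m - 2) by apply: leq_expl.
  have : 0 < 180 ^ (m - 2) by rewrite expn_gt0.
  rewrite (_ : 60 * 3 = 180) //; move: (155 ^ _) (180 ^ _) => p q; lia.
exists 5 => //.
rewrite -(ltn_pmul2r (_ : 0 < 3 ^ m)) ?expn_gt0 //.
have step1 : n * (5 ^ k.+1 * 6 ^ (m + 4 * k.+1)) * 3 ^ m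
    <= 30 ^ m * (5 * 6 ^ 4) ^ k.+1.
  rewrite expnD (expnM 6 4) (expnMn 5 6 m) (expnMn 5 (6 ^ 4) k.+1).
  rewrite (_ : n * _ * _ = n * 3 ^ m * (6 ^ m * (5 ^ k.+1 * (6 ^ 4) ^ k.+1))).
    by rewrite -!mulnA mulnA leq_mul2r hm orbT.
  by move: (6 ^ 4) => s; ring.
(* [5 * 6 ^ 4 / 10 ^ 4 = 81 / 125] *)
have step2 : 4 * (5 * 6 ^ 4) ^ k.+1 < 3 * (10 ^ 4) ^ k.+1.
  have step3 : 4 * 81 ^ k.+1 < 3 * 125 ^ k.+1.
    have : 81 ^ k <= 125 ^ k by apply: leq_expl.
    have : 0 < 125 ^ k by rewrite expn_gt0.
    rewrite !expnS; move: (81 ^ k) (125 ^ k) => p q; lia.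
  rewrite (_ : 5 * 6 ^ 4 = 80 * 81) // (_ : 10 ^ 4 = 80 * 125) //.
  by rewrite !(expnMn 80) !(mulnCA _ (80 ^ _)) ltn_pmul2l ?expn_gt0.
rewrite -mulnA; apply: (leq_ltn_trans (leq_mul (leqnn 4) step1)).
rewrite [X in _ < X](_ : _ = 30 ^ m * (3 * (10 ^ 4) ^ k.+1)).
  by rewrite mulnCA ltn_pmul2l ?expn_gt0.
rewrite expnD (expnM 10 4) (expnMn 10 3 m).
by move: (10 ^ 4) => s; ring.
Qed.

(** A set of neighbours with fewer than [color_degree v] colours misses some
    colour at [v], so a rainbow set of neighbours can be extended up to that
    size. *)
Lemma rainbow_neighbours (C : eqType) (G : ecgraph C) (v : G) (d : nat) :
  d <= color_degree v ->
  exists D : {set G}, [/\ #|D| = d, {in D, forall w, adj v w} &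
    {in D &, injective (color v)}].
Proof.
elim: d => [|d IH] hd.
  by exists set0; split; rewrite ?cards0 // => w; rewrite inE.
have [D [cD aD iD]] := IH (ltnW hd).
have [/existsP[w /andP[vw /negP new]]|none] :=
  boolP [exists w, adj v w && (color v w \notin [seq color v u | u in D])].
  have new' u : u \in D -> color v w != color v u.
    by move=> uD; apply/eqP => e; apply: new; rewrite e image_f.
  have wD : w \notin D by apply/negP => /new'; rewrite eqxx.
  exists (w |: D); split.
  - by rewrite cardsU1 wD cD.
  - by move=> u; rewrite !inE => /predU1P[->|/aD].
  - move=> u1 u2; rewrite !inE => /predU1P[->|u1D] /predU1P[->|u2D] //.
    + by move/eqP; rewrite (negPf (new' _ u2D)).
    + by move/eqP; rewrite eq_sym (negPf (new' _ u1D)).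
    + exact: iD.
exfalso; move: hd; apply/negP; rewrite -leqNgt -cD cardE -(size_map (color v)).
apply: uniq_leq_size (undup_uniq _) _ => c; rewrite mem_undup.
case/imageP => w vw ->; move: none; rewrite negb_exists => /forallP/(_ w).
by rewrite negb_and negbK; move: vw; rewrite inE => ->.
Qed.

(** Distinctly coloured neighbours that lie in [A] witness that many colours at
    [v] in the induced subgraph.  [A] has to be non-empty, as the minimum
    colour degree of the graph without vertices is [0]. *)
Lemma min_color_degree_induced_ge (C : eqType) (G : ecgraph C) (A : {set G})
    (D : G -> {set G}) (a : nat) :
  A != set0 ->
  (forall v, {in D v, forall w, adj v w}) ->
  (forall v, {in D v &, injective (color v)}) ->
  {in A, forall v, a <= #|D v :&: A|} ->
  a <= min_color_degree (induced A).
Proof.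
move=> /set0Pn[v0 v0A] aD iD hA.
have A0 : 0 < #|induced A| by apply/card_gt0P; exists (exist _ v0 v0A : induced A).
have [v ->] := min_color_degree_attained A0.
apply: leq_trans (hA (val v) (valP v)) _.
rewrite cardE -(size_map (color (val v))).
apply: uniq_leq_size.
  rewrite map_inj_in_uniq ?enum_uniq // => u w.
  rewrite !mem_enum => /setIP[uD _] /setIP[wD _]; exact: iD uD wD.
move=> c /mapP[w]; rewrite mem_enum => /setIP[wD wA] ->.
rewrite mem_undup; apply/imageP.
by exists (exist _ w wA : induced A); rewrite // inE; apply: aD wD.
Qed.

Section Exponential.
Import Order.TTheory GRing.Theory Num.Theory.
Local Open Scope ring_scope.

(** From [1 + y <= exp y] at [y = - 1 / 32]: the sixteenth power of [31 / 32]
    still exceeds [3 / 5], so [exp (- 1 / 2) >= 3 / 5]. *)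
Lemma expR_half_le (R : realType) : expR (2^-1 : R) <= 5 / 3.
Proof.
have h : 31 / 32 <= expR (- 32^-1 : R).
  by apply: le_trans (expR_ge1Dx _); lra.
have : (31 / 32) ^+ 16 <= expR (- 32^-1 : R) ^+ 16.
  by rewrite lerXn2r // nnegrE ?expR_ge0 //; lra.
rewrite -expRM_natl.
have -> : 16%:R * - 32^-1 = - 2^-1 :> R by field.
rewrite expRN => h2.
have : 3 / 5 <= 1 / expR (2^-1 : R) by rewrite div1r; apply: le_trans h2; lra.
by rewrite ler_pdivlMr ?expR_gt0 //; lra.
Qed.

(** The logarithmic hypothesis in integer form: the excess [m] of [d] over
    [4 * k] satisfies [n <= exp (m / 2) <= (5 / 3) ^ m]. *)
Lemma log_degree_bound (R : realType) (n d k : nat) :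
  (0 < n)%N -> 2 * ln (n%:R : R) + 4 * k%:R <= d%:R ->
  exists2 m, d = (m + 4 * k)%N & (n * 3 ^ m <= 5 ^ m)%N.
Proof.
move=> n0 h.
have ln0 : 0 <= ln (n%:R : R) by rewrite ln_ge0 // ler1n.
have kd : (4 * k <= d)%N by rewrite -(ler_nat R) natrM; lra.
exists (d - 4 * k)%N; first by rewrite subnK.
set m := (d - 4 * k)%N.
have mE : m%:R = d%:R - 4 * k%:R :> R by rewrite natrB // natrM.
have nE : n%:R <= (5 / 3) ^+ m :> R.
  rewrite -(@lnK _ (n%:R : R)) ?posrE ?ltr0n //.
  apply: (@le_trans _ _ (expR (m%:R * 2^-1))); first by rewrite ler_expR; lra.
  by rewrite expRM_natl lerXn2r ?nnegrE ?expR_ge0 ?expR_half_le //; lra.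
rewrite -(ler_nat R) natrM !natrX -ler_pdivlMr ?exprn_gt0 //.
by rewrite -expr_div_n.
Qed.

End Exponential.

Theorem theorem1p7 (R : realType) (C : eqType) (G : ecgraph C) (a b : nat)
    (hab : (b <= a)%N) (hb : (1 <= b)%N) (hn : (2 <= #|G|)%N)
    (hdeg : (2 * ln (#|G|%:R : R) + 4 * (a%:R - 1)
             <= (min_color_degree G)%:R :> R)%R) :
  exists A B : {set G}, feasible_partition a b A B.
Proof.
case: a => [|k] in hab hdeg *; first by case: b hb hab.
rewrite -(GRing.natrB _ (ltn0Sn k)) subn1 /= in hdeg.
have [m dE nm] := log_degree_bound (ltnW hn) hdeg.
have [D hD] :=
  fin_all_exists (fun v : G => rainbow_neighbours (min_color_degree_le v)).
have cD v : #|D v| = min_color_degree G by case: (hD v).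
have aD v : {in D v, forall w, adj v w} by case: (hD v).
have iD v : {in D v &, injective (color v)} by case: (hD v).
have vD v : v \notin D v by apply/negP => /aD; rewrite adj_irr.
(* [n <= (5 / 3) ^ m] with [n >= 2] forces [m >= 2], and [m <= d < n]. *)
have n3 : 2 < #|G|.
  have [v dv] := min_color_degree_attained (ltnW hn).
  have := color_degree_lt_card v; rewrite -dv dE.
  by case: m nm {dE} => [|[|m]] nm; lia.
have [x x0 hx] := union_bound_parameter k n3 nm.
rewrite -dE in hx.
have [S [S0 ST hS]] := exists_balanced_set n3 x0 cD vD hx.
exists S, (~: S); split.
  split=> //; last by rewrite -setI_eq0 setICr.
    by apply: contra ST => /eqP SC; rewrite -(setCK S) SC setC0.
  by rewrite setUCr.
have sideS v : v \in S -> same_side v S = S.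
  by move=> vS; apply/setP => w; rewrite inE vS eqb_id.
have sideC v : v \in ~: S -> same_side v S = ~: S.
  by rewrite inE => /negPf vS; apply/setP => w; rewrite !inE vS eqbF_neg.
split; last apply: leq_trans hab _; apply: (min_color_degree_induced_ge _ aD iD).
- by [].
- by move=> v vS; have := hS v; rewrite sideS.
- by apply: contra ST => /eqP SC; rewrite -(setCK S) SC setC0.
- by move=> v vS; have := hS v; rewrite sideC.
Qed.
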